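(* Let $\mathcal O_{(3,2^{2k})}\subset\mathfrak{so}(n,\mathbb C)$ denote the nilpotent orbit of Jordan type $(3,2^{2k},1^{n-4k-3})$, where $\mathfrak{so}(n,\mathbb C)$ consists of skew-symmetric complex $n\times n$ matrices. Let $X\in\mathcal O_{(3,2^{2k})}$ and denote by $x\in\mathbb C^n$ the (unique up to sign) column vector such that $X^2=x\,x^{\mathsf T}$. Then the hyperKähler potential $\rho$ of the canonical hyperKähler structure on $\mathcal O_{(3,2^{2k})}$ is given by $$\rho(X)=2\sum_{\mu_i\in\operatorname{Spec}(X'{X'}^* )}k_i\,\mu_i^{1/2},\qquad\text{where}\qquad X'=\begin{pmatrix}X&x\\-x^{\mathsf T}&0\end{pmatrix},$$ the sum being over the distinct eigenvalues $\mu_i$ of $X'{X'}^*$ and $k_i$ being the multiplicity of $\mu_i$.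
   Context: $\mathbb C^n$ and $\mathbb C^{n+1}$ carry the standard Hermitian inner products and standard quadratic forms; $X^*=\overline X^{\mathsf T}$. HyperKähler potential. A hyperKähler manifold is a Riemannian manifold with complex structures $I,J,K$ satisfying $IJ=K=-JI$, for each of which $g$ is Hermitian, and such that $\omega_I(X,Y)=g(X,IY)$, $\omega_J$, $\omega_K$ are closed. A real function $\rho$ is a hyperKähler potential if it is simultaneously a Kähler potential for $(\omega_I,I)$, $(\omega_J,J)$, $(\omega_K,K)$, normalised so that on a flat quaternionic vector space with norm $r$ the potential is $r^2$; that is, $\omega_A=\tfrac14\,d(d\rho\circ A)$ for $A=I,J,K$, with the usual exterior derivative. Canonical hyperKähler structure on $\mathcal O_{(3,2^{2k})}$ and its potential. Let $V_1=\mathbb C$, $V_2=\mathbb C^{2k+2}$, $V_3=\mathbb C^n$ with standard Hermitian products, and bilinear forms $\omega_1,\omega_3$ the standard quadratic forms and $\omega_2$ the skew form with matrix $\begin{pmatrix}0&\mathbf 1\\-\mathbf 1&0\end{pmatrix}$ in an orthonormal basis; let $\dagger$ denote adjoint with respect to the $\omega_i$. Let $W^+$ be the quaternionic vector space of tuples $(\alpha_1,\beta_1,\alpha_2,\beta_2)$ with $\alpha_i:V_i\to V_{i+1}$, $\beta_i=\alpha_i^\dagger:V_{i+1}\to V_i$, with norm $r^2=\sum_{i=1}^{2}\operatorname{Tr}(\alpha_i^*\alpha_i+\beta_i\beta_i^* )$, $I$ being multiplication by $\sqrt{-1}$ and $J$ being $(\alpha_i,\beta_i)\mapsto(-\beta_i^*,\alpha_i^*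 )$. The group $H=H_1\times H_2$, $H_i=\{A\in U(V_i):A^\dagger A=\mathrm{Id}\}$, acts naturally, and the zero set $\mu^{-1}(0)$ of its hyperKähler moment map is given by $\beta_1\alpha_1=0$, $\alpha_1\beta_1=\beta_2\alpha_2$, $\beta_1\beta_1^*=\alpha_1^*\alpha_1$, $\alpha_1\alpha_1^*+\beta_2\beta_2^*=\beta_1^*\beta_1+\alpha_2^*\alpha_2$. On the open subset of $\mu^{-1}(0)$ where $\alpha_1,\alpha_2$ are injective and $\beta_1,\beta_2$ surjective, the map $(\alpha_1,\beta_1,\alpha_2,\beta_2)\mapsto\alpha_2\beta_2$ induces a diffeomorphism from the quotient by $H$ onto $\mathcal O_{(3,2^{2k})}$. The hyperKähler quotient structure transported to the orbit is the canonical hyperKähler structure, and its hyperKähler potential is the function induced by $r^2$: $\rho(X)=r^2(\alpha,\beta)$ for any point of this subset with $\alpha_2\beta_2=X$. *)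

(* Defs.v *)
From HB Require Import structures.
From mathcomp Require Import all_boot all_order all_algebra.
From mathcomp Require Import boolp classical_sets fsbigop reals.
From mathcomp Require Export complex.

Set Implicit Arguments.
Unset Strict Implicit.
Unset Printing Implicit Defensive.

Import Order.TTheory GRing.Theory Num.Theory.

Local Open Scope sesquilinear_scope.
Local Open Scope classical_set_scope.
Local Open Scope ring_scope.

(* The field of complex numbers is R[i] with R : realType.  Elements of C^n   *)
(* are column vectors, linear maps act by left multiplication, and A ^t* is   *)
(* the conjugate transpose.                                                   *)

(** Nilpotent orbits of so(n, C) *)

(* Upper triangular Jordan matrix with diagonal blocks of sizes p_0, p_1, ... *)
(* [reshape_index p i] is the number of the block containing index i.         *)
Definition nilpotent_jordan_mx (R : realType) (n : nat) (p : seq nat) :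
    'M[R[i]]_n :=
  \matrix_(i, j) ((j == i.+1 :> nat) &&
                  (reshape_index p i == reshape_index p j))%:R.

Definition has_jordan_type (R : realType) (n : nat) (X : 'M[R[i]]_n)
    (p : seq nat) : Prop :=
  sumn p = n /\
  exists2 P : 'M[R[i]]_n,
    P \in unitmx & P *m X *m invmx P = nilpotent_jordan_mx R n p.

Definition so (R : realType) (n : nat) : set 'M[R[i]]_n :=
  [set X | X^T = - X].

(* Since the partition has an odd part, the skew-symmetric matrices of this   *)
(* Jordan type form a single SO(n, C)-orbit.                                  *)
Definition orbit_3_2 (R : realType) (n k : nat) : set 'M[R[i]]_n :=
  [set X | so X /\
     has_jordan_type X (3 :: nseq k.*2 2 ++ nseq (n - 4 * k - 3) 1)%N].

(** The quaternionic vector space W^+ and the hyperKaehler quotient *)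

(* Bilinear form with Gram matrix G. *)
Definition bilin (R : realType) (m : nat) (G : 'M[R[i]]_m)
    (u v : 'cV[R[i]]_m) : R[i] := (u^T *m G *m v) 0 0.

Definition is_adjoint (R : realType) (m p : nat)
    (Gm : 'M[R[i]]_m) (Gp : 'M[R[i]]_p)
    (a : 'M[R[i]]_(p, m)) (b : 'M[R[i]]_(m, p)) : Prop :=
  forall (u : 'cV[R[i]]_m) (v : 'cV[R[i]]_p),
    bilin Gp (a *m u) v = bilin Gm u (b *m v).

Definition sympl_mx (R : realType) (m : nat) : 'M[R[i]]_(m + m) :=
  block_mx 0 1%:M (- 1%:M) 0.

(* V_1 = C, V_2 = C^(2k+2), V_3 = C^n. *)
Record quiver_tuple (R : realType) (n k : nat) := QuiverTuple {
  alpha1 : 'M[R[i]]_(k.+1 + k.+1, 1);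
  beta1  : 'M[R[i]]_(1, k.+1 + k.+1);
  alpha2 : 'M[R[i]]_(n, k.+1 + k.+1);
  beta2  : 'M[R[i]]_(k.+1 + k.+1, n) }.

Definition Wplus (R : realType) (n k : nat) : set (quiver_tuple R n k) :=
  [set w | is_adjoint 1%:M (sympl_mx R k.+1) (alpha1 w) (beta1 w) /\
           is_adjoint (sympl_mx R k.+1) 1%:M (alpha2 w) (beta2 w)].

(* r^2; as a complex number it is automatically real and nonnegative. *)
Definition norm_sq (R : realType) (n k : nat) (w : quiver_tuple R n k) : R[i] :=
  \tr ((alpha1 w)^t* *m alpha1 w + beta1 w *m (beta1 w)^t*) +
  \tr ((alpha2 w)^t* *m alpha2 w + beta2 w *m (beta2 w)^t*).

Definition moment_zero (R : realType) (n k : nat) : set (quiver_tuple R n k) :=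
  [set w | [/\ beta1 w *m alpha1 w = 0,
               alpha1 w *m beta1 w = beta2 w *m alpha2 w,
               beta1 w *m (beta1 w)^t* = (alpha1 w)^t* *m alpha1 w &
               alpha1 w *m (alpha1 w)^t* + beta2 w *m (beta2 w)^t* =
               (beta1 w)^t* *m beta1 w + (alpha2 w)^t* *m alpha2 w]].

Definition mx_injective (R : realType) (m p : nat) (A : 'M[R[i]]_(m, p)) :=
  injective (fun u : 'cV[R[i]]_p => A *m u).

Definition mx_surjective (R : realType) (m p : nat) (A : 'M[R[i]]_(m, p)) :=
  forall v : 'cV[R[i]]_m, exists u : 'cV[R[i]]_p, A *m u = v.

Definition regular_locus (R : realType) (n k : nat) :
    set (quiver_tuple R n k) :=
  [set w | [/\ mx_injective (alpha1 w), mx_injective (alpha2 w),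
               mx_surjective (beta1 w) & mx_surjective (beta2 w)]].

(* Points of the open subset of the zero set lying over X. *)
Definition quotient_fibre (R : realType) (n k : nat) (X : 'M[R[i]]_n) :
    set (quiver_tuple R n k) :=
  [set w | [/\ Wplus w, moment_zero w, regular_locus w &
               alpha2 w *m beta2 w = X]].

Arguments quotient_fibre {R n} k X _.

(* [hk_potential_at k X r] says that rho(X) is defined and equal to r, where  *)
(* rho is the function induced by r^2 on the quotient: there are points over  *)
(* X, and norm_sq takes the value r at all of them.                           *)
Definition hk_potential_at (R : realType) (n k : nat) (X : 'M[R[i]]_n)
    (r : R[i]) : Prop :=
  quotient_fibre k X !=set0 /\
  forall w : quiver_tuple R n k, quotient_fibre k X w -> norm_sq w = r.

(** The spectral side *)

Definition bordered_mx (R : realType) (n : nat) (X : 'M[R[i]]_n)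
    (x : 'cV[R[i]]_n) : 'M[R[i]]_(n + 1) :=
  block_mx X x (- x^T) 0.

Definition Spec (R : realType) (m : nat) (M : 'M[R[i]]_m) : set R[i] :=
  [set mu | eigenvalue M mu].

Definition multiplicity (R : realType) (m : nat) (M : 'M[R[i]]_m)
    (mu : R[i]) : nat := mup mu (char_poly M).

(* Main.v *)
Require Import Defs.
From mathcomp Require Import all_boot all_order all_algebra.
From mathcomp Require Import boolp classical_sets fsbigop reals.
From mathcomp Require Import zify ring.

(** Complete a point (a, b, A, B) of the fibre over X to the rectangular
    matrices A' = col_mx A (- b) and B' = row_mx B a.  The first arrows are
    thereby absorbed into the second ones: b a = 0 and the adjunction relations
    give A' B' = bordered_mx X (A a), while a b = B A gives (A a)(A a)^T = X^2,
    so that A a is x or - x.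
    The remaining (real) moment map equation says exactly that
    A'^* A' = B' B'^*.  Hence, for X' = A' B',
      X' X'^* = A' (B' B'^* ) A'^* = (A' A'^* )^2,
    whose square root is the positive semidefinite matrix A' A'^*.  The sum of
    the square roots of the eigenvalues of X' X'^* is therefore
    tr (A' A'^* ) = tr (A'^* A'), while r^2 is tr (A'^* A') + tr (B' B'^* ), i.e.
    twice that number ([norm_sq_fibre]).  The spectral theorem turns this
    statement on square roots into one on multiplicities
    ([sum_sqrt_spectrum_gram]).

    The fibre is nonempty for a reason that also goes through X'.  The bordered
    matrix X' is skew, squares to 0 and has the rank 2k+2 of X.  A complex
    skew matrix has a normal form under unitary congruence, with 2 x 2 diagonal
    blocks; written without the unitary matrix, it says that X' = - A' J A'^T
    where J is the standard symplectic matrix, A' has full column rank and the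
    Gram matrix A'^* A' commutes with the quaternionic structure attached to J
    ([skew_factor], [skew_sympl_factor]).  Cutting the last row off such an A'
    yields the required point, the moment map equations being equivalent to
    X'^2 = 0 and to the condition on the Gram matrix ([fibre_of_factor]).

    The Jordan type of X enters only through rank X = 2k+2, X^3 = 0 and
    X^2 <> 0 of rank one ([orbit_3_2_square]). *)

Set Implicit Arguments.
Unset Strict Implicit.
Unset Printing Implicit Defensive.

Import Order.TTheory GRing.Theory Num.Theory.

Local Open Scope sesquilinear_scope.
Local Open Scope classical_set_scope.
Local Open Scope ring_scope.

(** * Symmetric matrices of rank one *)

(** Symmetry makes r proportional to c^T; the square root of the factor of
    proportionality is absorbed into the vector. *)
Lemma rank1_sym_square (C : numClosedFieldType) n (c : 'cV[C]_n) (r : 'rV_n) :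
  (c *m r)^T = c *m r -> exists x : 'cV[C]_n, c *m r = x *m x^T.
Proof.
set S := c *m r => symS.
have S_cr i j : S i j = c i 0 * r 0 j by rewrite mxE big_ord1.
have [c0|/cV0Pn [i ci0]] := altP (c =P 0).
  by exists 0; rewrite /S c0 !mul0mx.
exists (sqrtC (r 0 i / c i 0) *: c).
apply/matrixP => j l; rewrite S_cr [RHS]mxE big_ord1 !mxE.
have -> : c j 0 * r 0 l = r 0 i / c i 0 * c j 0 * c l 0.
  have crr : c i 0 * r 0 l = c l 0 * r 0 i by rewrite -!S_cr -[in LHS]symS mxE.
  by rewrite -[r 0 l](mulKf ci0) crr; ring.
by rewrite -{1}[r 0 i / c i 0](sqrtCK); ring.
Qed.

Lemma square_inj_sign (C : numClosedFieldType) n (x y : 'cV[C]_n) :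
  x *m x^T = y *m y^T -> y = x \/ y = - x.
Proof.
move=> /matrixP exy.
have {}exy i j : x i 0 * x j 0 = y i 0 * y j 0.
  by have := exy i j; rewrite !mxE !big_ord1 !mxE.
have [x0|] := altP (x =P 0).
  left; rewrite x0; apply/colP => i; rewrite mxE.
  by have /esym/eqP := exy i i; rewrite x0 mxE mul0r mulf_eq0 orbb => /eqP.
move=> /cV0Pn [i xi0].
have yi0 : y i 0 != 0.
  by apply: contraNneq xi0 => yi; have /eqP := exy i i; rewrite yi mul0r mulf_eq0 orbb.
have [e|e] : y i 0 = x i 0 \/ y i 0 = - x i 0.
  apply/pred2P; rewrite -(subr_eq0 (y i 0)) -(subr_eq0 _ (- _)) -mulf_eq0 opprK.
  by rewrite -subr_sqr !expr2 exy subrr.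
- by left; apply/colP => j; apply: (mulfI yi0); rewrite -exy e.
- by right; apply/colP => j; apply: (mulfI yi0); rewrite -exy e mxE mulrNN.
Qed.

(** * The Jordan matrix of type (3, 2, ..., 2, 1, ..., 1) *)

Lemma reshape_index_cons (m : nat) s i :
  reshape_index (m :: s) i =
  if (i < m)%N then 0 else (reshape_index s (i - m)).+1.
Proof.
rewrite /reshape_index /= subn_eq0; case: ltnP => // le_mi.
by rewrite subSn.
Qed.

Lemma reshape_index_nseq (m c : nat) s i : (0 < m)%N ->
  reshape_index (nseq c m ++ s) i =
  if (i < c * m)%N then (i %/ m)%N else (c + reshape_index s (i - c * m))%N.
Proof.
move=> m_gt0; elim: c i => [|c IHc] i; first by rewrite mul0n subn0.
rewrite [nseq _ _ ++ _]/= reshape_index_cons IHc.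
case: ltnP => [lt_im | le_mi].
  by rewrite divn_small // mulSn ltn_addr.
rewrite mulSn subnDA.
have -> : (i < m + c * m)%N = (i - m < c * m)%N by lia.
case: ifP => // _.
by rewrite -{2}(subnKC le_mi) divnDl // divnn m_gt0.
Qed.

(** The blocks of sizes 3, 2, ..., 2 start at 0, 3, 5, ..., so that the
    non-zero entries of the superdiagonal sit in row 0 and in the odd rows below
    4k+2. *)
Lemma jordan_3_2_entry (R : realType) n k (i j : 'I_n) :
  nilpotent_jordan_mx R n (3 :: nseq k.*2 2 ++ nseq (n - 4 * k - 3) 1)%N i j =
  [&& j == i.+1 :> nat, (i == 0 :> nat) || odd i & (i < 4 * k + 2)%N]%:R.
Proof.
rewrite mxE; congr ((nat_of_bool _)%:R).
have [ji|//] := altP (j =P i.+1 :> nat) => /=.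
have lt_jn := ltn_ord j; rewrite ji in lt_jn *.
rewrite -[nseq (n - _ - _)%N _]cats0 !reshape_index_cons !reshape_index_nseq //.
rewrite !divn1 muln1; do !case: ifP; lia.
Qed.

(** Such a partial permutation matrix factors as F^T G through two matrices
    whose rows are distinct basis vectors. *)
Lemma rank_injective_pairing (F : fieldType) r m n
    (f : 'I_r -> 'I_m) (g : 'I_r -> 'I_n) :
  injective f -> injective g ->
  \rank (\matrix_(i, j) [exists a, (i == f a) && (j == g a)]%:R : 'M[F]_(m, n)) = r.
Proof.
move=> f_inj g_inj.
pose E p (h : 'I_r -> 'I_p) : 'M[F]_(r, p) := \matrix_(a, i) (i == h a)%:R.
have freeE p (h : 'I_r -> 'I_p) : injective h -> row_free (E p h).
  move=> h_inj; apply/row_freeP; exists (E p h)^T; apply/matrixP => a b.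
  rewrite !mxE (bigD1 (h a)) //= big1 => [|i /negPf ni]; last by rewrite !mxE ni mul0r.
  by rewrite !mxE eqxx mul1r addr0 (inj_eq h_inj).
have -> : (\matrix_(i, j) [exists a, (i == f a) && (j == g a)]%:R : 'M[F]_(m, n))
    = (E m f)^T *m E n g.
  apply/matrixP => i j; rewrite !mxE; case: existsP => [[a /andP[/eqP-> /eqP->]]|none].
    rewrite (bigD1 a) //= big1 => [|b nb]; first by rewrite !mxE !eqxx mulr1 addr0.
    by rewrite !mxE (inj_eq f_inj) eq_sym (negPf nb) mul0r.
  rewrite big1 // => a _; rewrite !mxE -natrM mulnb.
  by case: andP => // /andP e; case: none; exists a.
rewrite mxrankMfree ?freeE // mxrank_tr; apply/eqP; exact: freeE.
Qed.

Lemma rank_jordan_3_2 (R : realType) n k : (4 * k + 3 <= n)%N ->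
  \rank (nilpotent_jordan_mx R n (3 :: nseq k.*2 2 ++ nseq (n - 4 * k - 3) 1)%N)
  = (k.+1 + k.+1)%N.
Proof.
move=> hn.
have ltf (a : 'I_(k.+1 + k.+1)) : (a.*2.-1 < n)%N by have := ltn_ord a; lia.
have ltg (a : 'I_(k.+1 + k.+1)) : (a.*2.-1.+1 < n)%N by have := ltn_ord a; lia.
(* The a-th non-zero row, among 0, 1, 3, 5, ..., has index a.*2.-1. *)
rewrite -(@rank_injective_pairing R[i] _ n n
  (fun a => Ordinal (ltf a)) (fun a => Ordinal (ltg a))).
- congr mxrank; apply/matrixP => i j; rewrite jordan_3_2_entry mxE.
  congr ((nat_of_bool _)%:R); apply/and3P/existsP => [[/eqP ji i_odd lt_i]|[a]].
    have lt_a : (uphalf i < k.+1 + k.+1)%N by lia.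
    by exists (Ordinal lt_a); rewrite -!val_eqE /= ji; apply/andP; lia.
  rewrite -!val_eqE /= => /andP[/eqP-> /eqP->]; have := ltn_ord a; split; lia.
- move=> a b /(congr1 val) /=; move=> e; apply: val_inj => /=; lia.
- move=> a b /(congr1 val) /=; move=> e; apply: val_inj => /=; lia.
Qed.

(** * Gram matrices and sums over the spectrum *)

Lemma adjmx_mul (C : numClosedFieldType) m n p (A : 'M[C]_(m, n)) (B : 'M_(n, p)) :
  (A *m B)^t* = B^t* *m A^t*.
Proof. by rewrite trmx_mul map_mxM. Qed.

Lemma adjmxN (C : numClosedFieldType) m n (A : 'M[C]_(m, n)) : (- A)^t* = - A^t*.
Proof. by rewrite linearN map_mxN. Qed.

Lemma mxtrace_gram (C : numClosedFieldType) m n (A : 'M[C]_(m, n)) :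
  \tr (A *m A^t*) = \sum_i \sum_j `|A i j| ^+ 2.
Proof.
apply: eq_bigr => i _; rewrite mxE; apply: eq_bigr => j _.
by rewrite !mxE normCK.
Qed.

Lemma gram_eq0 (C : numClosedFieldType) m n (A : 'M[C]_(m, n)) :
  A *m A^t* = 0 -> A = 0.
Proof.
move=> /(congr1 mxtrace); rewrite mxtrace_gram raddf0 => /eqP.
rewrite psumr_eq0 => [/allP sum0|i _]; last by apply: sumr_ge0 => j _; rewrite exprn_ge0.
apply/matrixP => i j; have /(_ i) := sum0; rewrite mem_index_enum => /(_ isT).
rewrite psumr_eq0 => [/allP /(_ j)|l _]; last by rewrite exprn_ge0.
by rewrite mem_index_enum => /(_ isT); rewrite expf_eq0 /= normr_eq0 mxE => /eqP.
Qed.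

Lemma gram_spectral (C : numClosedFieldType) m n (A : 'M[C]_(m, n)) :
  exists U : 'M[C]_m, exists2 d : 'rV[C]_m,
    U \is unitarymx /\ (forall i, 0 <= d 0 i) & A *m A^t* = U^t* *m diag_mx d *m U.
Proof.
set H := A *m A^t*.
have H_normal : H \is normalmx.
  by apply/normalmxP; rewrite adjmx_mul trmxCK.
have U_unitary := spectral_unitarymx H.
have defH := orthomx_spectralP H_normal.
rewrite invmx_unitary // in defH.
exists (spectralmx H), (spectral_diag H) => //; split=> // i.
(* d i is the squared norm of the i-th row of U A. *)
set U := spectralmx H in U_unitary defH *; set d := spectral_diag H in defH *.
have dE : diag_mx d = (U *m A) *m (U *m A)^t*.
  rewrite adjmx_mul mulmxA -(mulmxA U) -/H defH !mulmxA.
  by rewrite (unitarymxP U_unitary) mul1mx -mulmxA (unitarymxP U_unitary) mulmx1.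
have -> : d 0 i = diag_mx d i i by rewrite mxE eqxx mulr1n.
rewrite dE mxE; apply: sumr_ge0 => j _.
by rewrite !mxE -normCK exprn_ge0.
Qed.

(** Allows the eigenvalues delivered by a diagonalization to be summed without
    grouping the equal ones. *)
Lemma sum_spectrum (R : realType) m (M : 'M[R[i]]_m) (s : seq R[i]) (f : R[i] -> R[i]) :
  char_poly M = \prod_(z <- s) ('X - z%:P) ->
  \sum_(mu \in Spec M) (multiplicity M mu)%:R * f mu = \sum_(z <- s) f z.
Proof.
move=> char_s.
have -> : Spec M = [set` undup s].
  apply/seteqP; split=> z /=;
  by rewrite /Spec /= eigenvalue_root_char char_s root_prod_XsubC mem_undup.
transitivity (\sum_(z <- undup s) (multiplicity M z)%:R * f z).
  by rewrite (fsbig_seq _ (fun z : R[i] => (multiplicity M z)%:R * f z) (undup_uniq s)).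
rewrite -[RHS]big_undup_iterop_count; apply: eq_bigr => z _.
rewrite /multiplicity char_s mu_prod_XsubC.
by rewrite -[iterop _ _ _ _]/(f z *+ count_mem z s) mulr_natl.
Qed.

Lemma char_poly_conj (F : comNzRingType) m (V U D : 'M[F]_m) :
  V *m U = 1%:M -> char_poly (V *m D *m U) = char_poly D.
Proof.
move=> VU1; rewrite /char_poly.
have VU1X : map_mx polyC V *m map_mx polyC U = 1%:M by rewrite -map_mxM VU1 map_mx1.
have -> : char_poly_mx (V *m D *m U) =
    map_mx polyC V *m char_poly_mx D *m map_mx polyC U.
  rewrite /char_poly_mx mulmxBr mulmxBl !map_mxM /= mul_mx_scalar -scalemxAl.
  by rewrite VU1X scalemx1.
by rewrite !det_mulmx mulrAC -det_mulmx VU1X det1 mul1r.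
Qed.

(** M is the square of the positive semidefinite matrix A A^*: if d i are the
    eigenvalues of the latter, those of M are (d i)^2, with square roots d i. *)
Lemma sum_sqrt_spectrum_gram (R : realType) m n (A : 'M[R[i]]_(m, n)) :
  let M := (A *m A^t*) *m (A *m A^t*) in
  \sum_(mu \in Spec M) (multiplicity M mu)%:R * sqrtC mu = \tr (A *m A^t*).
Proof.
move=> M.
have [U [d [U_unitary d_ge0] defH]] := gram_spectral A.
pose s := [seq d 0 i ^+ 2 | i <- enum 'I_m].
have UUa := unitarymxP U_unitary.
have UaU : U^t* *m U = 1%:M by exact: mulmx1C.
rewrite (@sum_spectrum _ _ _ s).
  rewrite big_map big_enum /= defH mxtrace_mulC mulmxA UUa mul1mx mxtrace_diag.
  by apply: eq_bigr => i _; rewrite sqrCK.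
pose d2 := \row_i d 0 i ^+ 2.
have -> : M = U^t* *m diag_mx d2 *m U.
  rewrite /M defH !mulmxA -(mulmxA _ U) UUa mulmx1.
  rewrite -(mulmxA _ (diag_mx d) (diag_mx d)) mulmx_diag.
  by congr (_ *m diag_mx _ *m _); apply/rowP => i; rewrite !mxE expr2.
rewrite char_poly_conj // char_poly_trig ?diag_mx_is_trig // big_map big_enum.
by apply: eq_bigr => i _; rewrite !mxE eqxx mulr1n.
Qed.

(** * Normal form of complex skew matrices *)

(** The eigenvalue is recorded as a fourth power because both its square root
    (the singular value) and the square root of that (the length of the columns
    of the factor in [skew_factor]) are used. *)
Lemma gram_eigenvector (C : numClosedFieldType) n (S : 'M[C]_n) : S != 0 ->
  exists t : C, exists2 v : 'cV[C]_n,
    0 < t /\ v^t* *m v = 1%:M & S *m S^t* *m v = t ^+ 4 *: v.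
Proof.
move=> S_neq0; have [U [d [U_unitary d_ge0] defH]] := gram_spectral S.
have UUa := unitarymxP U_unitary.
have [i di_neq0] : exists i, d 0 i != 0.
  apply/rV0Pn; apply: contra_neq S_neq0 => d0; apply: gram_eq0.
  by rewrite defH d0 linear0 mulmx0 mul0mx.
have di_gt0 : 0 < d 0 i by rewrite lt_def di_neq0 d_ge0.
exists (sqrtC (sqrtC (d 0 i))), (U^t* *m delta_mx i 0).
  split; first by rewrite !sqrtC_gt0.
  rewrite adjmx_mul trmxCK mulmxA -(mulmxA _ U) UUa mulmx1.
  rewrite trmx_delta map_delta_mx mul_delta_mx.
  by apply/matrixP => a b; rewrite !ord1 !mxE !eqxx.
rewrite (exprM _ 2 2) !sqrtCK defH -!mulmxA (mulmxA U) UUa mul1mx.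
by rewrite scalemxAr; congr (_ *m _); rewrite mul_diag_mx; apply/colP => j;
  rewrite !mxE; case: (altP (j =P i)) => [->|]; rewrite ?mulr0.
Qed.

Lemma skew_quadratic0 (F : numDomainType) n (S : 'M[F]_n) (u : 'cV_n) :
  S^T = - S -> u^T *m S *m u = 0.
Proof.
move=> skewS; have : (u^T *m S *m u)^T = - (u^T *m S *m u).
  by rewrite !trmx_mul trmxK skewS mulNmx mulmxN mulmxA.
move=> /matrixP/(_ 0 0); rewrite [LHS]mxE [RHS]mxE => /eqP.
rewrite -subr_eq0 opprK -mulr2n mulrn_eq0 /= => /eqP q0.
by apply/matrixP => i j; rewrite !ord1 q0 mxE.
Qed.

(** Take a unit eigenvector v of S S^* with singular value s, and let
    w = s^-1 S conj(v).  Since S is skew, S conj(w) = - s v, and w is again a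
    unit vector, orthogonal to v.  Subtracting the block s (w v^T - v w^T) from S
    leaves a skew matrix of smaller rank whose image is orthogonal to v and w,
    and induction on the rank applies.  The last clause, which says that the
    columns of the factors lie in the image of S, is what makes the new columns
    orthogonal to those given by the induction. *)
Lemma skew_factor (C : numClosedFieldType) n (S : 'M[C]_n) : S^T = - S ->
  exists r, exists A1 A2 : 'M[C]_(n, r),
    [/\ S = A2 *m A1^T - A1 *m A2^T, A1^t* *m A1 \in unitmx,
        A1^t* *m A1 = (A2^t* *m A2)^T, A1^t* *m A2 = 0
      & forall u : 'rV_n, u *m S = 0 -> u *m A1 = 0 /\ u *m A2 = 0].
Proof.
have [k] := ubnP (\rank S); elim: k S => // k IHk S; rewrite ltnS => rkS skewS.
have [S0|S_neq0] := altP (S =P 0).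
  exists 0, 0, 0; split; rewrite ?S0 ?mulmx0 ?mul0mx ?trmx0 ?subr0 //.
    by rewrite unitmxE det_mx00 unitr1.
  by move=> u _; rewrite !mulmx0.
have [t [v [t_gt0 vv] Hv]] := gram_eigenvector S_neq0.
have t_neq0 : t != 0 by rewrite gt_eqF.
have conj_t : t^* = t by apply/CrealP; rewrite gtr0_real.
set s := t ^+ 2.
have s_neq0 : s != 0 by rewrite expf_neq0.
have conj_s : s^* = s by rewrite rmorphXn /= conj_t.
pose cj p q (A : 'M[C]_(p, q)) := map_mx Num.conj A.
have trmxT p q (A : 'M[C]_(p, q)) : (A^t*)^T = cj _ _ A.
  by rewrite map_trmx trmxK.
have adjS : S^t* = - cj _ _ S by rewrite skewS map_mxN.
(* Skewness gives S^* = - conj S, so that v is an eigenvector of S (conj S). *)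
have HvN : S *m (cj _ _ S *m v) = - (s ^+ 2 *: v).
  by rewrite -exprM -Hv adjS mulmxN mulNmx opprK mulmxA.
pose w := s^-1 *: (S *m cj _ _ v).
have Svc : S *m cj _ _ v = s *: w by rewrite scalerA mulfV // scale1r.
have Swc : S *m cj _ _ w = - (s *: v).
  have -> : cj _ _ w = s^-1 *: (cj _ _ S *m v).
    by rewrite /cj map_mxZ map_mxM map_mxCK fmorphV /= conj_s.
  by rewrite -scalemxAr HvN scalerN scalerA expr2 mulKf.
clearbody w.
have vaS : v^t* *m S = - (s *: w^T).
  by rewrite -[LHS]trmxK trmx_mul skewS mulNmx trmxT Svc linearN linearZ.
have waS : w^t* *m S = s *: v^T.
  by rewrite -[LHS]trmxK trmx_mul skewS mulNmx trmxT Swc opprK linearZ.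
have vw : v^t* *m w = 0.
  have := skew_quadratic0 (cj _ _ v) skewS; rewrite -{1}trmxT trmxK.
  rewrite -mulmxA Svc -scalemxAr => /eqP; rewrite scaler_eq0 (negPf s_neq0) /=.
  by move/eqP.
have wv : w^t* *m v = 0 by rewrite -[LHS]trmxCK adjmx_mul trmxCK vw trmx0 map_mx0.
have ww : w^t* *m w = 1%:M.
  apply: (scalerI s_neq0); rewrite scalemxAr -Svc mulmxA waS -scalemxAl.
  have -> : v^T *m cj _ _ v = (v^t* *m v)^T.
    by rewrite trmx_mul trmxT.
  by rewrite vv trmx1.
pose S1 := S - s *: (w *m v^T - v *m w^T).
have S1E : S1 = (1%:M - w *m w^t* - v *m v^t*) *m S.
  rewrite !mulmxBl mul1mx -!mulmxA waS vaS mulmxN -!scalemxAr /S1 scalerBr.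
  by rewrite opprK opprB addrA addrAC.
have skewS1 : S1^T = - S1.
  rewrite /S1 [LHS]linearB /= skewS linearZ /= [(_ - _)^T]linearB /= !trmx_mul !trmxK.
  by rewrite [RHS]opprD -scalerN !opprK opprB.
have S1wc : S1 *m cj _ _ w = 0.
  rewrite S1E -mulmxA Swc mulmxN -scalemxAr !mulmxBl mul1mx -!mulmxA wv vv.
  by rewrite mulmx0 mulmx1 subr0 subrr scaler0 oppr0.
have v_neq0 : v != 0.
  by apply: contra_eqN vv => /eqP ->; rewrite mulmx0 eq_sym matrix_nonzero1.
(* If the rank did not drop, S would be a left multiple of S1, hence kill conj w. *)
have rkS1 : (\rank S1 < \rank S)%N.
  rewrite rank_ltmx // ltmxE S1E submxMl /=; apply/submxP => -[D defS].
  have /eqP := Swc; rewrite defS -S1E -mulmxA S1wc mulmx0 eq_sym oppr_eq0.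
  by rewrite scaler_eq0 (negPf s_neq0) (negPf v_neq0).
have [r [B1 [B2 [defS1 B1_unit B12 B1B2 kerB]]]] := IHk S1 (leq_trans rkS1 rkS) skewS1.
have [vB1 vB2] : v^t* *m B1 = 0 /\ v^t* *m B2 = 0.
  apply: kerB; rewrite S1E mulmxA !mulmxBr mulmx1 !mulmxA vw vv mul0mx mul1mx.
  by rewrite subr0 subrr mul0mx.
have [wB1 wB2] : w^t* *m B1 = 0 /\ w^t* *m B2 = 0.
  apply: kerB; rewrite S1E mulmxA !mulmxBr mulmx1 !mulmxA wv ww mul0mx mul1mx.
  by rewrite subr0 subrr mul0mx.
have adj0 (u : 'cV[C]_n) (B : 'M_(n, r)) : u^t* *m B = 0 -> B^t* *m u = 0.
  by move=> e; rewrite -[LHS]trmxCK adjmx_mul trmxCK e trmx0 map_mx0.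
have adjtZ (u : 'cV[C]_n) : (t *: u)^t* = t *: u^t*.
  by rewrite linearZ /= map_mxZ /= conj_t.
exists (1 + r)%N, (row_mx (t *: v) B1), (row_mx (t *: w) B2).
rewrite !tr_row_mx !map_col_mx !mul_col_row !adjtZ.
have scale2 m q p (A : 'M[C]_(m, q)) (B : 'M_(q, p)) :
    (t *: A) *m (t *: B) = s *: (A *m B).
  by rewrite -scalemxAl -scalemxAr scalerA -expr2.
rewrite !scale2 vv ww vw -!(scalemxAl, scalemxAr) vB1 vB2 wB2 !adj0 //.
rewrite !scaler0.
split.
- rewrite !mul_row_col [(t *: v)^T]linearZ [(t *: w)^T]linearZ /= !scale2.
  rewrite opprD addrACA -scalerBr -defS1.
  by rewrite addrC subrK.
- rewrite unitmxE det_ublock unitrM -!unitmxE B1_unit andbT scalemx1.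
  by rewrite unitmxE det_scalar expr1 unitfE.
- by rewrite tr_block_mx !trmx0 linearZ /= trmx1 B12.
- by rewrite B1B2 block_mx0.
move=> u uS.
have uw : u *m w = 0.
  have /eqP := congr1 (mulmx u) Svc; rewrite mulmxA uS mul0mx -scalemxAr.
  by rewrite eq_sym scaler_eq0 (negPf s_neq0) /= => /eqP.
have uv : u *m v = 0.
  have /eqP := congr1 (mulmx u) Swc; rewrite mulmxA uS mul0mx mulmxN -scalemxAr.
  by rewrite eq_sym oppr_eq0 scaler_eq0 (negPf s_neq0) /= => /eqP.
have [uB1 uB2] : u *m B1 = 0 /\ u *m B2 = 0.
  apply: kerB; rewrite /S1 mulmxBr uS -scalemxAr mulmxBr !mulmxA uw uv !mul0mx.
  by rewrite subr0 scaler0 subr0.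
by rewrite !mul_mx_row -!scalemxAr uv uw uB1 uB2 scaler0 row_mx0.
Qed.

(** * The symplectic form *)

Section Sympl.
Variables (R : realType) (m : nat).
Local Notation J := (sympl_mx R m).

Lemma sympl_mxT : J^T = - J.
Proof. by rewrite tr_block_mx !trmx0 linearN /= trmx1 opp_block_mx !oppr0 opprK. Qed.

Lemma sympl_mx_sq : J *m J = - 1%:M.
Proof.
rewrite mulmx_block !mul0mx !mulmx0 !mul1mx !mulmx1 !add0r addr0.
by rewrite [in RHS]scalar_mx_block opp_block_mx oppr0.
Qed.

Lemma sympl_mx_adj : J^t* = - J.
Proof.
by rewrite sympl_mxT map_mxN map_block_mx !map_mx0 map_mxN map_mx1.
Qed.

Lemma sympl_mxTK : J^T *m J = 1%:M.
Proof. by rewrite sympl_mxT mulNmx sympl_mx_sq opprK. Qed.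

Lemma sympl_mxKT : J *m J^T = 1%:M.
Proof. by rewrite sympl_mxT mulmxN sympl_mx_sq opprK. Qed.

Lemma sympl_mx_free : row_free J.
Proof. by apply/row_freeP; exists J^T; exact: sympl_mxKT. Qed.

End Sympl.

(** The last identity says that the Gram matrix Q = A^* A satisfies
    Q = J (conj Q) J^-1, i.e. commutes with the quaternionic structure
    u |-> J (conj u); conj Q is written Q^T because Q is hermitian.  With the
    two halves of the columns taken from [skew_factor], Q is block diagonal with
    blocks E and conj E. *)
Lemma skew_sympl_factor (R : realType) n (S : 'M[R[i]]_n) : S^T = - S ->
  exists r, exists A : 'M[R[i]]_(n, r + r),
    let J := sympl_mx R r in
    [/\ S = - (A *m J *m A^T), \rank A = (r + r)%N, \rank S = (r + r)%N
      & A^t* *m A = J *m (A^t* *m A)^T *m J^T].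
Proof.
move=> skewS; have [r [A1 [A2 [defS A1_unit A12 A1A2 _]]]] := skew_factor skewS.
have A2A1 : A2^t* *m A1 = 0 by rewrite -[LHS]trmxCK adjmx_mul trmxCK A1A2 trmx0 map_mx0.
exists r, (row_mx A1 A2) => J.
have gramA : (row_mx A1 A2)^t* *m row_mx A1 A2 =
    block_mx (A1^t* *m A1) 0 0 (A1^t* *m A1)^T.
  by rewrite tr_row_mx map_col_mx mul_col_row A1A2 A2A1 A12 trmxK.
have defSJ : S = - (row_mx A1 A2 *m J *m (row_mx A1 A2)^T).
  rewrite mul_row_block !mulmx0 mulmxN !mulmx1 add0r addr0 tr_row_mx mul_row_col.
  by rewrite mulNmx opprD opprK -defS.
have rkA : \rank (row_mx A1 A2) = (r + r)%N.
  apply/eqP; rewrite eqn_leq rank_leq_col /=.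
  apply: leq_trans (mxrankM_maxr ((row_mx A1 A2)^t*) (row_mx A1 A2)).
  rewrite gramA mxrank_unit // unitmxE det_ublock unitrM det_tr.
  by rewrite -unitmxE A1_unit.
split=> //.
  rewrite defSJ mxrank_opp mxrankMfree; last by rewrite /row_free mxrank_tr rkA.
  by rewrite mxrankMfree // sympl_mx_free.
rewrite gramA sympl_mxT tr_block_mx !trmx0 trmxK mulmxN !mulmx_block.
rewrite !(mul0mx, mulmx0, mul1mx, mulmx1, mulNmx, mulmxN, addr0, add0r).
by rewrite opp_block_mx !oppr0 !opprK.
Qed.

(** * The fibre over X *)

Lemma is_adjointP (R : realType) m p (Gm : 'M[R[i]]_m) (Gp : 'M[R[i]]_p) a b :
  is_adjoint Gm Gp a b <-> a^T *m Gp = Gm *m b.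
Proof.
rewrite /is_adjoint /bilin; split=> [adj|adj u v]; last first.
  by rewrite trmx_mul -!mulmxA (mulmxA a^T) adj !mulmxA.
apply/matrixP => i j; have := adj (delta_mx i 0) (delta_mx j 0).
rewrite trmx_mul !trmx_delta -!mulmxA (mulmxA a^T) (mulmxA Gm) !mulmxA.
by rewrite -!(mulmxA (delta_mx 0 i)) -!rowE -!colE !mxE.
Qed.

Lemma mx_injective_rank (R : realType) m p (A : 'M[R[i]]_(m, p)) :
  \rank A = p -> mx_injective A.
Proof.
move=> rkA u v /= /(congr1 trmx); rewrite !trmx_mul => /row_free_inj e.
by apply: trmx_inj; apply: e; rewrite /row_free mxrank_tr rkA.
Qed.

Lemma mx_surjective_rank (R : realType) m p (A : 'M[R[i]]_(m, p)) :
  \rank A = m -> mx_surjective A.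
Proof.
move=> rkA v; have /row_freeP [B AB1] : row_free A by rewrite /row_free rkA.
by exists (B *m v); rewrite mulmxA AB1 mul1mx.
Qed.

Section Fibre.
Variables (R : realType) (n k : nat).
Local Notation J := (sympl_mx R k.+1).
Implicit Types (a : 'M[R[i]]_(k.+1 + k.+1, 1)) (A : 'M[R[i]]_(n, k.+1 + k.+1)).

Lemma fibre_bordered a b A B :
  a^T *m J = b -> A^T = J *m B -> b *m a = 0 ->
  bordered_mx (A *m B) (A *m a) = col_mx A (- b) *m row_mx B a.
Proof.
move=> defb defB ba0; rewrite mul_col_row !mulNmx ba0 oppr0 /bordered_mx.
by rewrite trmx_mul defB mulmxA defb.
Qed.

Lemma fibre_square a b A B :
  a^T *m J = b -> A^T = J *m B -> a *m b = B *m A ->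
  A *m B *m (A *m B) = (A *m a) *m (A *m a)^T.
Proof.
move=> defb defB ab; have -> : (A *m a)^T = b *m B by rewrite trmx_mul defB mulmxA defb.
by rewrite [RHS]mulmxA -(mulmxA A a) ab !mulmxA.
Qed.

(** With A' = col_mx A (- b) and B' = row_mx B a, the last hypothesis is
    B' B'^* = A'^* A'; hence M = (A' A'^* )^2, and both halves of the norm equal
    tr (A'^* A'). *)
Lemma norm_sq_bordered a b A B :
  a^T *m J = b -> A^T = J *m B -> b *m a = 0 ->
  a *m a^t* + B *m B^t* = b^t* *m b + A^t* *m A ->
  let M := bordered_mx (A *m B) (A *m a) *m (bordered_mx (A *m B) (A *m a))^t* in
  norm_sq (QuiverTuple a b A B) =
    2 * \sum_(mu \in Spec M) (multiplicity M mu)%:R * sqrtC mu.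
Proof.
move=> defb defB ba0 real_moment /=.
rewrite (fibre_bordered defb defB ba0); set A' := col_mx A (- b); set B' := row_mx B a.
have gramA : A'^t* *m A' = b^t* *m b + A^t* *m A.
  rewrite tr_col_mx map_row_mx mul_row_col adjmxN mulNmx mulmxN opprK.
  by rewrite addrC.
have gramB : B' *m B'^t* = a *m a^t* + B *m B^t*.
  by rewrite tr_row_mx map_col_mx mul_row_col addrC.
have -> : A' *m B' *m (A' *m B')^t* = (A' *m A'^t*) *m (A' *m A'^t*).
  rewrite adjmx_mul !mulmxA -(mulmxA A' B') gramB real_moment -gramA.
  by rewrite !mulmxA.
rewrite sum_sqrt_spectrum_gram mxtrace_mulC gramA mulr_natl mulr2n -{1}real_moment.
rewrite /norm_sq /= !mxtraceD.
rewrite (mxtrace_mulC a) (mxtrace_mulC b) [RHS]addrACA.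
by congr (_ + _); rewrite addrC.
Qed.

(** A a is only known to be x up to sign; the sign is corrected by replacing
    (a, b) with (- a, - b), which leaves all equations and the norm unchanged. *)
Lemma norm_sq_fibre X (x : 'cV[R[i]]_n) (w : quiver_tuple R n k) :
  quotient_fibre k X w -> X *m X = x *m x^T ->
  let M := bordered_mx X x *m (bordered_mx X x)^t* in
  norm_sq w = 2 * \sum_(mu \in Spec M) (multiplicity M mu)%:R * sqrtC mu.
Proof.
case: w => a b A B [/= [/is_adjointP + /is_adjointP +] []] /=.
rewrite mul1mx mulmx1 => defb defB ba0 ab bb real_moment _ <- sqX.
have [->|->] := square_inj_sign (etrans (esym (fibre_square defb defB ab)) sqX).
  exact: norm_sq_bordered.
have -> : norm_sq (QuiverTuple a b A B) = norm_sq (QuiverTuple (- a) (- b) A B).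
  by rewrite /norm_sq /= !adjmxN !mulmxN !mulNmx !opprK.
rewrite -mulmxN; apply: norm_sq_bordered => //.
- by rewrite linearN /= mulNmx defb.
- by rewrite mulmxN mulNmx ba0 !oppr0.
by rewrite !adjmxN !mulmxN !mulNmx !opprK.
Qed.

(** The point is read off from A': A consists of its first n rows and - b is the
    last one, while B consists of the first n columns of B' = - J A'^T and a is
    the last one, as the adjunction relations force.  Since A' is
    injective and B' surjective, X'^2 = A' B' A' B' = 0 amounts to B' A' = 0,
    which is the complex moment map equation; the real one is the hypothesis on
    the Gram matrix. *)
Lemma fibre_of_factor X (x : 'cV[R[i]]_n) (A' : 'M[R[i]]_(n + 1, k.+1 + k.+1)) :
  bordered_mx X x = - (A' *m J *m A'^T) -> \rank A' = (k.+1 + k.+1)%N ->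
  \rank X = (k.+1 + k.+1)%N -> x != 0 ->
  bordered_mx X x *m bordered_mx X x = 0 ->
  A'^t* *m A' = J *m (A'^t* *m A')^T *m J^T ->
  quotient_fibre k X !=set0.
Proof.
move=> defS rkA' rkX x_neq0 sqS gramA'.
pose A := usubmx A'; pose c := dsubmx A'.
have defA' : A' = col_mx A c by rewrite vsubmxK.
pose a := - (J *m c^T); pose b := - c; pose B := - (J *m A^T).
pose B' := row_mx B a.
have defB' : B' = - (J *m A'^T).
  by rewrite defA' tr_col_mx mul_mx_row opp_row_mx.
have defSAB : bordered_mx X x = A' *m B' by rewrite defS defB' mulmxN mulmxA.
have A'_inj p (D E : 'M_(_, p)) : A' *m D = A' *m E -> D = E.
  move=> /(congr1 trmx); rewrite !trmx_mul => /row_free_inj e.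
  by apply: trmx_inj; apply: e; rewrite /row_free mxrank_tr rkA'.
have B'_free : row_free B'.
  rewrite defB' /row_free mxrank_opp mxrankMfree.
    exact: sympl_mx_free.
  by rewrite /row_free mxrank_tr rkA'.
have BA0 : B' *m A' = 0.
  apply: (row_free_inj B'_free); apply: A'_inj.
  by rewrite mul0mx mulmx0 -(mulmxA B') (mulmxA A') -defSAB sqS.
have /eq_block_mx [defX defx _ ca0] : block_mx X x (- x^T) 0 =
    block_mx (A *m B) (A *m a) (c *m B) (c *m a).
  by rewrite -mul_col_row -defA' -defSAB.
have BAac : B *m A + a *m c = 0 by rewrite -BA0 defA' mul_row_col.
have defb : a^T *m J = b.
  rewrite linearN /= trmx_mul trmxK mulNmx -mulmxA sympl_mxTK.
  by rewrite mulmx1.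
have defB : A^T = J *m B.
  by rewrite mulmxN mulmxA sympl_mx_sq mulNmx mul1mx opprK.
have x_neq0' : A *m a != 0 by rewrite -defx.
have a_neq0 : a != 0 by apply: contraNneq x_neq0' => ->; rewrite mulmx0.
have b_neq0 : b != 0.
  apply: contraNneq a_neq0 => /eqP; rewrite oppr_eq0 /a => /eqP ->.
  by rewrite trmx0 mulmx0 oppr0.
have adjT p q (D : 'M[R[i]]_(p, q)) : D^T^t* = D^t*^T by rewrite map_trmx.
exists (QuiverTuple a b A B); split => /=.
- by split; apply/is_adjointP; rewrite /= ?mul1mx ?mulmx1.
- split=> /=.
  + by rewrite mulNmx -ca0 oppr0.
  + by apply/eqP; rewrite mulmxN eq_sym -subr_eq0 opprK BAac.
  + rewrite /a /b !adjmxN !mulmxN !mulNmx !opprK adjmx_mul mulmxA -(mulmxA _ (J^t*)).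
    rewrite sympl_mx_adj -sympl_mxT sympl_mxTK mulmx1 adjT -trmx_mul.
    by apply/matrixP => i j; rewrite [RHS]mxE !ord1.
  + transitivity (B' *m B'^t*).
      by rewrite tr_row_mx map_col_mx mul_row_col addrC.
    transitivity (A'^t* *m A').
      rewrite gramA' defB' adjmxN mulmxN mulNmx opprK adjmx_mul sympl_mx_adj -sympl_mxT.
      by rewrite adjT trmx_mul !mulmxA.
    by rewrite defA' tr_col_mx map_row_mx mul_row_col adjmxN mulNmx mulmxN opprK addrC.
- split=> /=.
  + by apply: mx_injective_rank; rewrite -mxrank_tr rank_rV trmx_eq0 a_neq0.
  + apply: mx_injective_rank; apply/eqP; rewrite eqn_leq rank_leq_col -[X in (X <= _)%N]rkX.
    by rewrite defX mxrankM_maxl.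
  + by apply: mx_surjective_rank; rewrite rank_rV b_neq0.
  + apply: mx_surjective_rank; apply/eqP; rewrite eqn_leq rank_leq_row -[X in (X <= _)%N]rkX.
    by rewrite defX mxrankM_maxr.
- by [].
Qed.

End Fibre.

(** * The orbit and the bordered matrix *)

Lemma orbit_3_2_square (R : realType) n k (X : 'M[R[i]]_n) :
  (4 * k + 3 <= n)%N -> orbit_3_2 k X ->
  [/\ \rank X = (k.+1 + k.+1)%N, X *m X *m X = 0, X *m X != 0 &
    exists x : 'cV[R[i]]_n, X *m X = x *m x^T].
Proof.
move=> hn [skewX [_ [P P_unit]]].
have := rank_jordan_3_2 R hn; have := @jordan_3_2_entry R n k.
set N := nilpotent_jordan_mx _ _ _ => N_entry rkN defN.
have lt0 : (0 < n)%N by lia.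
have lt2 : (2 < n)%N by lia.
have lt1 : (1 < n)%N by lia.
have N_mul (i l j : 'I_n) : N i l * N l j =
    [&& i == Ordinal lt0, l == Ordinal lt1 & j == Ordinal lt2]%:R.
  rewrite !N_entry -natrM mulnb -!val_eqE /=; congr ((nat_of_bool _)%:R).
  by apply/idP/idP; lia.
(* Only the block of size 3 contributes to the square. *)
have N2 : N *m N = delta_mx (Ordinal lt0) (Ordinal lt2).
  apply/matrixP => i j; rewrite !mxE (bigD1 (Ordinal lt1)) //= big1 => [|l /negPf l1].
    by rewrite N_mul eqxx addr0.
  by rewrite N_mul l1 andbF.
have N3 : N *m N *m N = 0.
  rewrite N2; apply/matrixP => i j; rewrite !mxE big1 // => l _.
  rewrite mxE N_entry -natrM mulnb -!val_eqE /=.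
  by rewrite (_ : _ && _ = false) //; apply/negP; lia.
have defX : X = invmx P *m N *m P by rewrite -defN !mulmxA mulVmx // mul1mx mulmxKV.
have sqX : X *m X = invmx P *m (N *m N) *m P.
  by rewrite defX !mulmxA mulmxK.
have sqX_neq0 : X *m X != 0.
  apply: contraTneq (oner_neq0 R[i]) => X2; rewrite negbK; apply/eqP.
  have : N *m N = P *m (X *m X) *m invmx P.
    by rewrite sqX !mulmxA mulmxV // mul1mx mulmxK.
  rewrite X2 mulmx0 mul0mx.
  by rewrite N2 => /matrixP /(_ (Ordinal lt0) (Ordinal lt2)); rewrite !mxE !eqxx.
split=> //.
- by rewrite defX mxrankMfree ?row_free_unit // eqmxMfull // row_full_unit unitmx_inv.
- by rewrite sqX defX !mulmxA mulmxK // -!(mulmxA (invmx P)) N3 mul0mx mulmx0.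
have defX2 : X *m X = (invmx P *m delta_mx (Ordinal lt0) 0) *m
    (delta_mx (0 : 'I_1) (Ordinal lt2) *m P).
  by rewrite sqX N2 !mulmxA -(mulmxA (invmx P) (delta_mx _ _)) mul_delta_mx.
rewrite defX2; apply: rank1_sym_square; rewrite -defX2 trmx_mul.
by rewrite [X^T]skewX mulmxN mulNmx opprK.
Qed.

(** The image of X^2 = x x^T is spanned by x, so that x = X y for some y.  Then
    X x = 0 because X^3 = 0, and x is isotropic by skewness; this is X'^2 = 0.
    Since y^T X y = 0 as well, X' is the pullback of X along row_mx 1 y, hence
    has the same rank. *)
Lemma bordered_mx_skew_sq0 (R : realType) n (X : 'M[R[i]]_n) (x : 'cV[R[i]]_n) :
  X^T = - X -> X *m X = x *m x^T -> X *m X *m X = 0 -> x != 0 ->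
  [/\ (bordered_mx X x)^T = - bordered_mx X x,
      bordered_mx X x *m bordered_mx X x = 0 &
      \rank (bordered_mx X x) = \rank X].
Proof.
move=> skewX sqX cubeX x_neq0.
have /cV0Pn [i xi_neq0] := x_neq0.
have colx : x *m x^T *m delta_mx i 0 = x i 0 *: x.
  rewrite -mulmxA -colE -mul_mx_scalar; congr (_ *m _).
  by apply/matrixP => a b; rewrite !ord1 !mxE eqxx mulr1n.
pose y := (x i 0)^-1 *: (X *m delta_mx i 0 : 'cV_n).
have defx : x = X *m y.
  by rewrite -scalemxAr mulmxA sqX colx scalerA mulVf // scale1r.
have Xx0 : X *m x = 0.
  by rewrite [in LHS]defx -!scalemxAr !mulmxA cubeX mul0mx scaler0.
have xTx0 : x^T *m x = 0.
  by rewrite {1}defx trmx_mul skewX mulmxN mulNmx -mulmxA Xx0 mulmx0 oppr0.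
split.
- by rewrite tr_block_mx linearN /= trmxK skewX trmx0 opp_block_mx oppr0 opprK.
- rewrite mulmx_block !mulmx0 !addr0 mulmxN sqX subrr Xx0 !mulNmx xTx0 oppr0.
  have -> : x^T *m X = 0 by rewrite -[LHS]trmxK trmx_mul skewX trmxK mulNmx Xx0 oppr0 trmx0.
  by rewrite !oppr0 mul0mx addr0 block_mx0.
apply/eqP; rewrite eqn_leq; apply/andP; split.
  have -> : bordered_mx X x = col_mx 1%:M y^T *m X *m row_mx 1%:M y.
    rewrite mul_col_mx mul_col_row !mul1mx !mulmx1 (skew_quadratic0 y skewX).
    by rewrite -defx /bordered_mx [in - x^T]defx trmx_mul skewX mulmxN opprK.
  exact: leq_trans (mxrankM_maxl _ _) (mxrankM_maxr _ _).
have {1}-> : X = row_mx 1%:M 0 *m bordered_mx X x *m col_mx 1%:M 0.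
  by rewrite mul_row_block mul_row_col !mul1mx !mul0mx !mulmx0 mulmx1 !addr0.
exact: leq_trans (mxrankM_maxl _ _) (mxrankM_maxr _ _).
Qed.

Theorem lemma5p1 (R : realType) (n k : nat) (hn : (4 * k + 3 <= n)%N)
    (X : 'M[R[i]]_n) (hX : orbit_3_2 k X) :
  (exists x : 'cV[R[i]]_n, X *m X = x *m x^T /\
     forall y : 'cV[R[i]]_n, X *m X = y *m y^T -> y = x \/ y = - x) /\
  (forall x : 'cV[R[i]]_n, X *m X = x *m x^T ->
     let M := bordered_mx X x *m (bordered_mx X x)^t* in
     hk_potential_at k X
       (2 * \sum_(mu \in Spec M) (multiplicity M mu)%:R * sqrtC mu)).
Proof.
have [rkX cubeX sqX_neq0 [x0 sqX0]] := orbit_3_2_square hn hX.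
split; first by exists x0; split=> // y; rewrite sqX0; exact: square_inj_sign.
move=> x sqX M; split; last by move=> w w_fibre; exact: norm_sq_fibre.
have x_neq0 : x != 0 by apply: contraNneq sqX_neq0 => x_eq0; rewrite sqX x_eq0 mul0mx.
have [skewS sqS rkS] := bordered_mx_skew_sq0 (proj1 hX) sqX cubeX x_neq0.
have [r [A [defS rkA rkSr gramA]]] := skew_sympl_factor skewS.
have er : r = k.+1.
  by apply: double_inj; rewrite -!addnn -rkSr rkS rkX.
subst r.
exact: fibre_of_factor defS rkA rkX x_neq0 sqS gramA.
Qed.
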